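(* Let $n,m,N\ge 1$ be integers, let $\mathbf{a}\in\mathbb{R}_+^n$ and $\mathbf{b}\in\mathbb{R}_+^m$ be probability vectors, let $\mathbf{C}\in\mathbb{R}^{n\times m}$ be a cost matrix, and let $\mathbf{M}\in\mathbb{R}_+^{n\times m}$ be a capacity matrix. Define $$U_M(\mathbf{a},\mathbf{b})=\Big\{\mathbf{F}\in U(\mathbf{a},\mathbf{b}) : \mathbf{F}=\sum_{i=1}^N\gamma^i \text{ for some } \gamma^1,\dots,\gamma^N\in\mathbb{R}^{n\times m} \text{ with } 0\le\gamma^i_{j,k}\le\mathbf{M}_{j,k}\ \text{for all } i,j,k\Big\}$$ and $$U_M^{Unif}(\mathbf{a},\mathbf{b})=\Big\{\mathbf{P}\in U(\mathbf{a},\mathbf{b}) : \mathbf{P}=N\cdot\widehat{\gamma} \text{ for some } \widehat{\gamma}\in\mathbb{R}^{n\times m} \text{ with } 0\le\widehat{\gamma}_{j,k}\le\mathbf{M}_{j,k}\ \text{for all } j,k\Big\}.$$ Then $$\inf_{\mathbf{F}\in U_M(\mathbf{a},\mathbf{b})}\langle\mathbf{C},\mathbf{F}\rangle=\inf_{\mathbf{P}\in U_M^{Unif}(\mathbf{a},\mathbf{b})}\langle\mathbf{C},\mathbf{P}\rangle.$$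
   Context: $\mathbb{R}_+$ denotes the non-negative reals. A probability vector is a vector with non-negative entries summing to $1$. $\mathbf{1}$ denotes the all-ones column vector of the appropriate length. The set of transport plans is $U(\mathbf{a},\mathbf{b})=\{\mathbf{P}\in\mathbb{R}_+^{n\times m}:\mathbf{P}\mathbf{1}=\mathbf{a},\ \mathbf{P}^T\mathbf{1}=\mathbf{b}\}$, and $\langle\mathbf{C},\mathbf{P}\rangle=\sum_{j,k}\mathbf{C}_{j,k}\mathbf{P}_{j,k}$ is the Frobenius inner product. The infimum over the empty set is $+\infty$. *)

(* Defs.v *)
From mathcomp Require Import all_boot all_order all_algebra.
From mathcomp Require Import classical_sets reals constructive_ereal ereal.

Set Implicit Arguments.
Unset Strict Implicit.
Unset Printing Implicit Defensive.

Import Order.TTheory GRing.Theory Num.Theory.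
Local Open Scope classical_set_scope.
Local Open Scope ring_scope.

Definition probability_vector (R : realType) (n : nat) (a : 'cV[R]_n) : Prop :=
  (forall j, 0 <= a j 0) /\ \sum_j a j 0 = 1.

Definition transport_plans (R : realType) (n m : nat)
    (a : 'cV[R]_n) (b : 'cV[R]_m) : set 'M[R]_(n, m) :=
  [set P : 'M[R]_(n, m) |
    [/\ forall j k, 0 <= P j k,
        P *m (const_mx 1 : 'cV[R]_m) = a &
        P^T *m (const_mx 1 : 'cV[R]_n) = b]].

Definition frobenius (R : realType) (n m : nat) (C P : 'M[R]_(n, m)) : R :=
  \sum_j \sum_k C j k * P j k.

Definition within_capacity (R : realType) (n m : nat)
    (M g : 'M[R]_(n, m)) : Prop :=
  forall j k, 0 <= g j k <= M j k.

Definition capacity_plans (R : realType) (n m N : nat)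
    (a : 'cV[R]_n) (b : 'cV[R]_m) (M : 'M[R]_(n, m)) : set 'M[R]_(n, m) :=
  [set F | transport_plans a b F /\
    exists g : 'I_N -> 'M[R]_(n, m),
      (forall i, within_capacity M (g i)) /\ F = \sum_(i < N) g i].

Definition uniform_capacity_plans (R : realType) (n m N : nat)
    (a : 'cV[R]_n) (b : 'cV[R]_m) (M : 'M[R]_(n, m)) : set 'M[R]_(n, m) :=
  [set P | transport_plans a b P /\
    exists g : 'M[R]_(n, m), within_capacity M g /\ P = N%:R *: g].

(* The infimum is taken in the extended reals, so it is +oo on the empty set. *)
Definition optimal_cost (R : realType) (n m : nat) (C : 'M[R]_(n, m))
    (U : set 'M[R]_(n, m)) : \bar R :=
  ereal_inf [set (frobenius C P)%:E | P in U].

(* Main.v *)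
(** Both infima range over the same set: the average of [N] matrices lying
    between [0] and [M] lies between [0] and [M], and conversely [N] equal
    summands are a special case of [N] arbitrary ones. *)
Require Import Defs.
From mathcomp Require Import all_boot all_order all_algebra.
From mathcomp Require Import classical_sets reals constructive_ereal ereal.

Set Implicit Arguments.
Unset Strict Implicit.
Unset Printing Implicit Defensive.

Import Order.TTheory GRing.Theory Num.Theory.
Local Open Scope ring_scope.

Lemma within_capacity_mean (R : realType) (n m N : nat) (M : 'M[R]_(n, m))
    (g : 'I_N -> 'M[R]_(n, m)) :
  (0 < N)%N -> (forall i, within_capacity M (g i)) ->
  within_capacity M (N%:R^-1 *: \sum_(i < N) g i).
Proof.
move=> N_gt0 gM j k; rewrite mxE summxE.
have NR_gt0 : 0 < N%:R :> R by rewrite ltr0n.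
apply/andP; split.
  by rewrite mulr_ge0 ?invr_ge0 ?ler0n// sumr_ge0// => i _; case/andP: (gM i j k).
rewrite ler_pdivrMl// mulr_natl.
(* The bound is spread over [N] equal terms so that the two sums compare summand by summand. *)
have -> : M j k *+ N = \sum_(i < N) M j k by rewrite sumr_const card_ord.
by apply: ler_sum => i _; case/andP: (gM i j k).
Qed.

Lemma capacity_plans_uniform (R : realType) (n m N : nat)
    (a : 'cV[R]_n) (b : 'cV[R]_m) (M : 'M[R]_(n, m)) :
  (0 < N)%N -> capacity_plans N a b M = uniform_capacity_plans N a b M.
Proof.
move=> N_gt0; apply/seteqP; split=> F [Fab [g [gM FE]]]; split=> //.
  (* The common share is the mean of the [g i]; scaling it by [N], which is nonzero, gives back
     their sum. *)
  exists (N%:R^-1 *: \sum_(i < N) g i).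
  split; first exact: within_capacity_mean.
  by rewrite scalerA divff ?scale1r// pnatr_eq0 -lt0n.
by exists (fun=> g); split=> //; rewrite FE sumr_const card_ord scaler_nat.
Qed.

Theorem mainTheorem1 (R : realType) (n m N : nat)
    (hn : (1 <= n)%N) (hm : (1 <= m)%N) (hN : (1 <= N)%N)
    (a : 'cV[R]_n) (b : 'cV[R]_m) (C M : 'M[R]_(n, m))
    (ha : probability_vector a) (hb : probability_vector b)
    (hM : forall j k, 0 <= M j k) :
  optimal_cost C (capacity_plans N a b M) =
  optimal_cost C (uniform_capacity_plans N a b M).
(* The feasible sets coincide, so the infima agree for every [C], both being [+oo] when no plan is
   feasible. *)
Proof. by rewrite capacity_plans_uniform. Qed.
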